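(* If $p\in\mathcal T$ belongs to the compact phase, then the probability that an edge at the origin belongs to a tricolor path of length $L$ decays exponentially fast as a function of $L$. That is, there exist $C,c>0$ such that for every edge $e$ of the tessellation incident to the cell centered at the origin and every $L\ge1$, the $\mathbb P_p$-probability that $e$ belongs to a tricolor path consisting of $L$ edges is at most $Ce^{-cL}$.
   Context: Let $\mathcal L=2\mathbb Z^3\cup(2\mathbb Z^3+(1,1,1))$ and consider its Voronoi tessellation of $\mathbb R^3$ (by truncated octahedra). Cells are indexed by their centers $v\in\mathcal L$; cells $v,w$ are adjacent (share a face) iff $v-w\in\{(\pm2,0,0),(0,\pm2,0),(0,0,\pm2)\}$ or $v-w\in\{(\pm1,\pm1,\pm1)\}$. Faces, edges and vertices of the tessellation correspond bijectively to sets of $2$, $3$ and $4$ mutually adjacent cells respectively; incidence corresponds to inclusion. Let $\mathcal T=\{p\in[0,1]^3:p_1+p_2+p_3=1\}$. For $p\in\mathcal T$, $\mathbb P_p$ is the law of the random coloring in which each cell independently gets color $i\in\{1,2,3\}$ (red, yellow, blue) with probability $p_i$. A tricolor edge is an edge of the tessellation whose three incident cells have three different colors; a tricolor vertex is a vertex incident to cells of all three colors. Each tricolor vertex is incident to exactly two tricolor edges and each tricolor edge to two tricolor vertices, so tricolor edges form disjoint loops and/or infinite paths. A tricolor path is a path of consecutive distinct tricolor edges; its length is the number of its edges. For $n\ge1$ an integer, let $A_n=([-3n,3n]^3\setminus[-n,n]^3)\cap\mathcal L$. $E_n$ is the event that there is a tricolor path from a vertex on the interior boundary of $A_n$ (a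 vertex of the tessellation incident both to a cell in $A_n$ and to a cell in $\mathcal L\cap[-n,n]^3$) to a vertex on the exterior boundary of $A_n$ (a vertex incident both to a cell in $A_n$ and to a cell in $\mathcal L\setminus[-3n,3n]^3$). A vector $p\in\mathcal T$ lies in the compact phase if $\mathbb P_p(E_n)$ tends to zero exponentially fast in $n$, i.e. $\mathbb P_p(E_n)\le C'e^{-c'n}$ for some $C',c'>0$ and all $n$. *)

(* Defs.v *)
From HB Require Import structures.
From mathcomp Require Import all_boot all_order all_algebra finmap.
From mathcomp Require Import all_classical all_reals all_analysis.

Set Implicit Arguments.
Unset Strict Implicit.
Unset Printing Implicit Defensive.

Import Order.TTheory GRing.Theory Num.Theory.

Local Open Scope classical_set_scope.
Local Open Scope fset_scope.
Local Open Scope ring_scope.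

Definition in_lattice (v : 'rV[int]_3) : bool :=
  [forall i, (2 %| v ord0 i)%Z] || [forall i, (2 %| v ord0 i - 1)%Z].

(** A cell is identified with its center. *)
Definition cell := {v : 'rV[int]_3 | in_lattice v}.

Lemma in_lattice0 : in_lattice 0.
Proof. by apply/orP; left; apply/forallP => i; rewrite mxE dvdz0. Qed.

Definition origin : cell := exist _ 0 in_lattice0.

Definition adjacent (v w : cell) : bool :=
  let d := val v - val w in
  [exists i : 'I_3, (d == 2 *: delta_mx 0 i) || (d == - 2 *: delta_mx 0 i)]
  || [forall i : 'I_3, (d ord0 i == 1) || (d ord0 i == - 1)].

Definition mutually_adjacent (s : {fset cell}) : Prop :=
  forall v w, v \in s -> w \in s -> v != w -> adjacent v w.

(** Edges and vertices are encoded as the sets of 3, resp. 4, mutually adjacent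
    cells they are incident to, so an edge [e] is incident to a vertex [x] iff
    [e `<=` x]. *)
Definition is_edge (e : {fset cell}) : Prop :=
  #|` e| = 3%N /\ mutually_adjacent e.

Definition is_vertex (x : {fset cell}) : Prop :=
  #|` x| = 4%N /\ mutually_adjacent x.

Definition coloring := cell -> 'I_3.

Definition tricolor_edge (c : coloring) (e : {fset cell}) : Prop :=
  is_edge e /\ (forall v w, v \in e -> w \in e -> v != w -> c v != c w).

Definition tricolor_vertex (c : coloring) (x : {fset cell}) : Prop :=
  is_vertex x /\ (forall i : 'I_3, exists2 v, v \in x & c v = i).

(** The path traverses the pairwise distinct edges [es = e_0, ..., e_(L-1)] and
    visits the vertices [xs = x_0, ..., x_L], the endpoints of [e_k] being [x_k]
    and [x_(k+1)].  Only the edges are required to be distinct: the path may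
    close up into a loop, and its length is [size es]. *)
Definition tricolor_path (c : coloring) (xs es : seq {fset cell}) : Prop :=
  [/\ size xs = (size es).+1,
      uniq es,
      forall x, x \in xs -> tricolor_vertex c x,
      forall e, e \in es -> tricolor_edge c e
    & forall k, (k < size es)%N ->
        let x := nth fset0 xs k in
        let y := nth fset0 xs k.+1 in
        let e := nth fset0 es k in
        [/\ x != y, e `<=` x & e `<=` y]].

Definition in_cube (n : nat) (v : cell) : bool :=
  [forall i, `|val v ord0 i| <= n%:Z].

Definition annulus (n : nat) (v : cell) : bool :=
  in_cube (3 * n) v && ~~ in_cube n v.

Definition interior_boundary (n : nat) (x : {fset cell}) : Prop :=
  [/\ is_vertex x, exists2 v, v \in x & annulus n v
    & exists2 w, w \in x & in_cube n w].

Definition exterior_boundary (n : nat) (x : {fset cell}) : Prop :=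
  [/\ is_vertex x, exists2 v, v \in x & annulus n v
    & exists2 w, w \in x & ~~ in_cube (3 * n) w].

Definition crossing (n : nat) : set coloring :=
  [set c | exists xs es : seq {fset cell},
    [/\ tricolor_path c xs es, interior_boundary n (head fset0 xs)
      & exterior_boundary n (last fset0 xs)]].

Definition on_path_of_length (e : {fset cell}) (L : nat) : set coloring :=
  [set c | exists xs es : seq {fset cell},
    [/\ tricolor_path c xs es, size es = L & e \in es]].

HB.instance Definition _ (n : nat) := isPointed.Build 'I_n.+1 ord0.

(** The product sigma-algebra is generated by the colors of single cells. *)
Definition single_cell_events : set (set coloring) :=
  [set A | exists (v : cell) (i : 'I_3), A = [set c | c v = i]].

Definition coloring_space := g_sigma_algebraType single_cell_events.

Definition in_simplex (R : realType) (p : 'I_3 -> R) : Prop :=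
  (forall i, 0 <= p i <= 1) /\ \sum_i p i = 1.

(** The colors of any finite set of cells are independent, each with
    distribution [p].  These sets form a pi-system generating the product
    sigma-algebra, so this determines [P] uniquely. *)
Definition is_coloring_law (R : realType) (p : 'I_3 -> R)
    (P : probability coloring_space R) : Prop :=
  forall (s : {fset cell}) (f : cell -> 'I_3),
    P [set c | forall v, v \in s -> c v = f v] = (\prod_(v <- s) p (f v))%:E.

Definition compact_phase (R : realType) (P : probability coloring_space R) :
    Prop :=
  exists C c : R, [/\ 0 < C, 0 < c &
    forall n : nat, (1 <= n)%N ->
      (P (crossing n) <= (C * expR (- c * n%:R))%:E)%E].

(* Main.v *)
(** Fix [n], to be chosen large. A long tricolor path through the origin cannot
    stay in a bounded region, so every cell [v] it passes realizes, within
    distance [3n + 2] of [v], the translate of the crossing event [E_n]. For cells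
    at pairwise distance more than [r = 6n + 4] these local crossings are
    independent. A path of length [L] passes [m] such cells, [m] proportional to
    [L], which can be chosen one at a time, each within [r + 2] of an earlier one;
    they are then visited by a walk of [2(m - 1)] steps of size at most [r + 2]
    started at the origin. There are at most [(4 D^2)^m] ways to choose such a walk
    and the cells on it, [D] being the number of cells in a ball of radius [r + 2],
    so the path has probability at most [(4 D^2 P(E_n))^m]. As [D] is polynomial in
    [n], the base is smaller than [1/e] for some [n] in the compact phase. *)

Require Import Defs.
From mathcomp Require Import all_boot all_order all_algebra finmap.
From mathcomp Require Import all_classical all_reals all_analysis.
From mathcomp Require Import zify ring lra.

Set Implicit Arguments.
Unset Strict Implicit.
Unset Printing Implicit Defensive.
Import Order.TTheory GRing.Theory Num.Theory.
Local Open Scope fset_scope.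
Local Open Scope ring_scope.

(** * Lattice translations, sup-norm distance and cubes of cells *)

Lemma in_latticeD (u v : 'rV[int]_3) :
  in_lattice u -> in_lattice v -> in_lattice (u + v).
Proof.
by case/orP=> /forallP hu /orP [] /forallP hv; apply/orP;
  [left|right|right|left]; apply/forallP => i; have := hu i; have := hv i;
  rewrite mxE; move: (u _ _) (v _ _) => a b; lia.
Qed.

Lemma in_latticeN (u : 'rV[int]_3) : in_lattice u -> in_lattice (- u).
Proof.
by case/orP=> /forallP hu; apply/orP; [left|right]; apply/forallP => i;
  have := hu i; rewrite mxE; move: (u _ _) => a; lia.
Qed.

Definition addc (u v : cell) : cell :=
  exist _ (val u + val v) (in_latticeD (valP u) (valP v)).

Definition oppc (u : cell) : cell := exist _ (- val u) (in_latticeN (valP u)).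

Lemma oppcK : involutive oppc.
Proof. by move=> u; apply: val_inj; rewrite /= opprK. Qed.

Lemma addNcK (u : cell) : cancel (addc u) (addc (oppc u)).
Proof. by move=> v; apply: val_inj; rewrite /= addKr. Qed.

Lemma addcNK (u : cell) : cancel (addc (oppc u)) (addc u).
Proof. by move=> v; apply: val_inj; rewrite /= addNKr. Qed.

Lemma addNc (u : cell) : addc (oppc u) u = origin.
Proof. by apply: val_inj; rewrite /= addNr. Qed.

Lemma addc_inj (u : cell) : injective (addc u).
Proof. exact: can_inj (addNcK u). Qed.

(* [closec k u v]: the sup-norm distance between [u] and [v] is at most [k]. *)
Definition closec (k : nat) (u v : cell) : bool := in_cube k (addc (oppc u) v).

Lemma in_cubeP (k : nat) (v : cell) :
  reflect (forall i, `|val v ord0 i| <= k%:Z) (in_cube k v).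
Proof. exact: forallP. Qed.

Lemma in_cube_origin (k : nat) : in_cube k origin.
Proof. by apply/in_cubeP => i; rewrite /= mxE normr0. Qed.

Lemma in_cubeN (k : nat) (v : cell) : in_cube k (oppc v) = in_cube k v.
Proof. by apply: eq_forallb => i; rewrite /= mxE normrN. Qed.

Lemma in_cubeD (j k : nat) (u v : cell) :
  in_cube j u -> in_cube k v -> in_cube (j + k) (addc u v).
Proof.
move=> /in_cubeP hu /in_cubeP hv; apply/in_cubeP => i; rewrite /= mxE PoszD.
by rewrite (le_trans (ler_normD _ _)) // lerD.
Qed.

Lemma in_cube_le (j k : nat) (v : cell) :
  (j <= k)%N -> in_cube j v -> in_cube k v.
Proof.
by move=> jk /in_cubeP hv; apply/in_cubeP => i; apply: le_trans (hv i) _.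
Qed.

Lemma closec_refl (k : nat) (u : cell) : closec k u u.
Proof. by rewrite /closec addNc in_cube_origin. Qed.

Lemma closec_sym (k : nat) (u v : cell) : closec k u v = closec k v u.
Proof.
rewrite /closec -in_cubeN; congr in_cube; apply: val_inj => /=.
by rewrite opprD opprK addrC.
Qed.

Lemma closec_trans (j k : nat) (u v w : cell) :
  closec j u v -> closec k v w -> closec (j + k) u w.
Proof.
move=> huv hvw; have := in_cubeD huv hvw; congr (in_cube _ _).
by apply: val_inj; rewrite /= addrA addrK.
Qed.

Lemma closec_le (j k : nat) (u v : cell) :
  (j <= k)%N -> closec j u v -> closec k u v.
Proof. exact: in_cube_le. Qed.

Lemma closec0 (k : nat) (v : cell) : closec k origin v = in_cube k v.
Proof. by congr in_cube; apply: val_inj; rewrite /= oppr0 add0r. Qed.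

Lemma in_cube_close (j k : nat) (u v : cell) :
  in_cube j u -> closec k u v -> in_cube (j + k) v.
Proof. by rewrite -!closec0; exact: closec_trans. Qed.

Lemma adjacent_close (u v : cell) : Defs.adjacent u v -> closec 2 u v.
Proof.
move=> uv; rewrite closec_sym; apply/in_cubeP => i; rewrite [val _]/= addrC.
case/orP: uv => [/existsP[j /orP[] /eqP ->]|/forallP/(_ i) /orP[] /eqP ->] //;
  by rewrite !mxE; case: (_ && _).
Qed.

Lemma adjacent_shift (a u v : cell) :
  Defs.adjacent (addc a u) (addc a v) = Defs.adjacent u v.
Proof. by rewrite /Defs.adjacent /= opprD addrACA subrr add0r. Qed.

(* The cells of the cube, listed by their coordinates shifted into [0, 2k]. *)
Definition cube (k : nat) : seq cell :=
  [seq v <- [seq insubd origin (\row_i ((f i : nat)%:Z - k%:Z))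
    | f : {ffun 'I_3 -> 'I_(k.*2.+1)}] | in_cube k v].

Lemma mem_cube (k : nat) (v : cell) : (v \in cube k) = in_cube k v.
Proof.
rewrite mem_filter andb_idr // => /in_cubeP hv.
apply/mapP; exists [ffun i => inord (absz (val v ord0 i + k%:Z))].
  by rewrite mem_enum.
rewrite [X in insubd _ X](_ : _ = val v) ?valKd //.
apply/rowP => i; rewrite mxE ffunE inordK; have := hv i;
  move: (val v _ _) => x; lia.
Qed.

Lemma size_cube (k : nat) : (size (cube k) <= k.*2.+1 ^ 3)%N.
Proof.
rewrite size_filter.
by apply: leq_trans (count_size _ _) _; rewrite size_map -cardE card_ffun !card_ord.
Qed.

Definition fcube (k : nat) : {fset cell} := [fset v in cube k].

Lemma in_fcube (k : nat) (v : cell) : (v \in fcube k) = in_cube k v.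
Proof. by rewrite inE mem_cube. Qed.

Definition shiftc (a : cell) (s : {fset cell}) : {fset cell} :=
  [fset addc a v | v in s].

Lemma mem_shift (a v : cell) (s : {fset cell}) :
  (addc a v \in shiftc a s) = (v \in s).
Proof. by rewrite mem_imfset //=; exact: addc_inj. Qed.

Lemma in_shift (a v : cell) (s : {fset cell}) :
  (v \in shiftc a s) = (addc (oppc a) v \in s).
Proof. by rewrite -{1}(addcNK a v) mem_shift. Qed.

Lemma shiftK (a : cell) : cancel (shiftc a) (shiftc (oppc a)).
Proof.
by move=> s; apply/fsetP => v; rewrite in_shift oppcK mem_shift.
Qed.

(** * Events determined by finitely many cells: independence and translation invariance *)

Section FiniteDependence.
Local Open Scope classical_set_scope.

Definition cylinder (s : {fset cell}) (c : coloring) : set coloring_space :=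
  [set c' | forall v, v \in s -> c' v = c v].

(** As [c] and [c'] can be exchanged, the single implication amounts to an equivalence. *)
Definition depends_on (s : {fset cell}) (A : set coloring_space) : Prop :=
  forall c c' : coloring, (forall v, v \in s -> c v = c' v) -> A c -> A c'.

Lemma measurable_cylinder (s : {fset cell}) (c : coloring) :
  measurable (cylinder s c).
Proof.
rewrite (_ : cylinder s c =
    \bigcap_(v in [set` s]) [set c' : coloring_space | c' v = c v]) //.
apply: fin_bigcap_measurable; first exact: finite_fset.
by move=> v _; apply: sub_sigma_algebra; exists v, (c v).
Qed.

(** The color [ord0] off [s] is arbitrary: the result is only tested on events depending on [s]. *)
Definition extend (s : {fset cell}) (f : {ffun s -> 'I_3}) : coloring :=
  fun v => if insub v is Some x then f x else ord0.

Lemma extendE (s : {fset cell}) (f : {ffun s -> 'I_3}) (x : s) :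
  extend f (val x) = f x.
Proof. by rewrite /extend valK. Qed.

Lemma extend_restrict (s : {fset cell}) (c : coloring) (v : cell) :
  v \in s -> extend [ffun x : s => c (val x)] v = c v.
Proof. by move=> vs; rewrite (extendE _ [` vs]) ffunE. Qed.

(** Finite decomposition into cylinders, one for each coloring of [s] allowed by [A]. The parameters
    make it serve twice: [T] the identity with [X] a second event for independence, [T] a
    translation with [X] everything for invariance. *)
Lemma preimage_depends_on (T : coloring_space -> coloring_space)
    (X A : set coloring_space) (s : {fset cell}) : depends_on s A ->
  (T @^-1` A) `&` X = \bigcup_(f in [set f : {ffun s -> 'I_3} | A (extend f)])
    ((T @^-1` cylinder s (extend f)) `&` X).
Proof.
move=> hA; apply/seteqP; split=> [c [/= Ac Xc]|c [f /= Af [cf Xc]]].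
  exists [ffun x : s => T c (val x)]; last first.
    by split=> // v vs; rewrite extend_restrict.
  by apply: hA Ac => v vs; rewrite extend_restrict.
by split=> //; apply: hA Af => v vs; rewrite cf.
Qed.

Lemma measurable_depends_on (s : {fset cell}) (A : set coloring_space) :
  depends_on s A -> measurable A.
Proof.
move=> hA; rewrite -[A]setIT -[A](@preimage_id coloring_space).
rewrite (preimage_depends_on _ _ hA).
apply: fin_bigcup_measurable => [|f _]; first exact: finite_finset.
by rewrite setIT; exact: measurable_cylinder.
Qed.

Variables (R : realType) (P : probability coloring_space R).

Lemma prob_preimage_depends_on (T : coloring_space -> coloring_space)
    (X A : set coloring_space) (s : {fset cell}) :
  (forall c, measurable ((T @^-1` cylinder s c) `&` X)) -> depends_on s A ->
  P ((T @^-1` A) `&` X) =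
    (\sum_(f \in [set f : {ffun s -> 'I_3} | A (extend f)])
      P ((T @^-1` cylinder s (extend f)) `&` X))%E.
Proof.
move=> mX hA; rewrite (preimage_depends_on _ _ hA) measure_fin_bigcup //.
  exact: finite_finset.
move=> f g _ _ [c [[cf _] [cg _]]]; apply/ffunP => x.
by rewrite -!extendE -cf ?cg // fsvalP.
Qed.

Variable p : 'I_3 -> R.
Hypothesis hP : is_coloring_law p P.

Lemma prob_cylinder (s : {fset cell}) (c : coloring) :
  P (cylinder s c) = (\prod_(v <- s) p (c v))%:E.
Proof. exact: hP. Qed.

(** The two colorings glue to a coloring [d] of the union, and the product of weights over a
    disjoint union factorizes. *)
Lemma prob_cylinderI (s t : {fset cell}) (c c' : coloring) :
  [disjoint s & t]%fset ->
  P (cylinder s c `&` cylinder t c') = (P (cylinder s c) * P (cylinder t c'))%E.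
Proof.
move=> st; have ts v : v \in t -> v \in s = false.
  by move=> vt; apply: contraTF vt => vs; exact: (fdisjointP st).
pose d v := if v \in s then c v else c' v.
rewrite (_ : _ `&` _ = cylinder (s `|` t)%fset d); last first.
  apply/seteqP; split=> [c1 [h1 h2] v|c1 h].
    by rewrite inE /d; case: ifP => [vs _|_ /= vt]; [exact: h1|exact: h2].
  split=> v hv; rewrite h ?inE ?hv ?orbT // /d; first by rewrite hv.
  by rewrite ts.
rewrite !prob_cylinder -EFinM; congr EFin.
rewrite (perm_big (s ++ t)) ?big_cat /=; last first.
  apply: uniq_perm => [||v]; rewrite ?fset_uniq //; last by rewrite inE mem_cat.
  rewrite cat_uniq !fset_uniq /= andbT; apply/hasPn => v vt.
  by rewrite /= ts.
congr (_ * _); apply: eq_big_seq => v hv; rewrite /d ?hv //.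
by rewrite ts.
Qed.

(** Bilinear extension from cylinders: [B] is cut into cylinders, and for each of these ([cylI]) so
    is [A]. *)
Lemma prob_dependsI (s t : {fset cell}) (A B : set coloring_space) :
  [disjoint s & t]%fset -> depends_on s A -> depends_on t B ->
  P (A `&` B) = (P A * P B)%E.
Proof.
have cylI (s' t' : {fset cell}) (A' : set coloring_space) c :
    [disjoint s' & t']%fset -> depends_on s' A' ->
    P (A' `&` cylinder t' c) = (P A' * P (cylinder t' c))%E.
  move=> st hA; rewrite -[A'](@preimage_id coloring_space).
  rewrite (prob_preimage_depends_on (s := s')) //; last first.
    by move=> c'; apply: measurableI; exact: measurable_cylinder.
  rewrite -[X in (P X * _)%E]setIT (prob_preimage_depends_on (s := s')) //; last first.
    by move=> c'; rewrite setIT; exact: measurable_cylinder.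
  rewrite ge0_mule_fsuml; last by [].
  apply: eq_fsbigr => f _; rewrite setIT prob_cylinderI //.
move=> st hA hB; rewrite setIC -[B](@preimage_id coloring_space).
rewrite (prob_preimage_depends_on (s := t)) //; last first.
  move=> c; apply: measurableI; first exact: measurable_cylinder.
  exact: measurable_depends_on hA.
rewrite -[X in (_ * P X)%E]setIT (prob_preimage_depends_on (s := t)) //; last first.
  by move=> c'; rewrite setIT; exact: measurable_cylinder.
rewrite ge0_mule_fsumr; last by [].
by apply: eq_fsbigr => f _; rewrite setIT setIC (cylI s).
Qed.

(** By induction: the events of the tail jointly depend on the union of their supports, which is
    disjoint from the support of the first. *)
Lemma prob_depends_bigcap (I : choiceType) (l : seq I) (s : I -> {fset cell})
    (A : I -> set coloring_space) :
  pairwise (fun i j => [disjoint s i & s j]%fset) l ->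
  (forall i, depends_on (s i) (A i)) ->
  P [set c | forall i, i \in l -> A i c] = (\prod_(i <- l) P (A i))%E.
Proof.
move=> hl hA; elim: l hl => [_|i l IH /= /andP[il hl]].
  by rewrite big_nil -(probability_setT P); congr (P _); apply/seteqP; split.
rewrite big_cons -IH // -(@prob_dependsI (s i) (\bigcup_(j <- l) s j)%fset) //.
- congr (P _); apply/seteqP; split=> [c h|c [h1 h2] j].
    by split=> [|j jl]; apply: h; rewrite inE ?eqxx ?jl ?orbT.
  by rewrite inE => /orP[/eqP ->|/h2].
- apply/fdisjointP => v vi; apply/bigfcupP => -[j]; rewrite andbT => jl.
  by apply/negP; move/(allP il)/fdisjointP: jl; apply.
- move=> c c' cc' h j jl; apply: hA (h j jl) => v vj; apply: cc'.
  by apply/bigfcupP; exists j; rewrite ?jl.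
Qed.

(** Recenters the coloring at [a]: the origin receives the color that [a] has in [c]. *)
Definition translate (a : cell) (c : coloring_space) : coloring_space := c \o addc a.

Lemma preimage_translate_cylinder (a : cell) (s : {fset cell}) (c : coloring) :
  translate a @^-1` cylinder s c =
  cylinder (shiftc a s) (translate (oppc a) c).
Proof.
apply/seteqP; split=> c' h v hv.
  by rewrite /translate /= -h -?in_shift // /translate /= addcNK.
by rewrite /translate /= h ?mem_shift // /translate /= addNcK.
Qed.

Lemma depends_on_translate (a : cell) (s : {fset cell}) (A : set coloring_space) :
  depends_on s A -> depends_on (shiftc a s) (translate a @^-1` A).
Proof.
move=> hA c c' cc'; apply: hA => v vs.
by rewrite /translate /= cc' // mem_shift.
Qed.

(** Translation maps cylinders to cylinders of equal weight, because [p] is the same at every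
    cell. *)
Lemma prob_translate (a : cell) (s : {fset cell}) (A : set coloring_space) :
  depends_on s A -> P (translate a @^-1` A) = P A.
Proof.
move=> hA; rewrite -[X in P X]setIT (prob_preimage_depends_on (s := s)) //; last first.
  by move=> c; rewrite setIT preimage_translate_cylinder; exact: measurable_cylinder.
rewrite -[X in _ = P X](@preimage_id coloring_space) -[X in _ = P X]setIT.
rewrite (prob_preimage_depends_on (s := s)) //; last first.
  by move=> c; rewrite setIT; exact: measurable_cylinder.
apply: eq_fsbigr => f _; rewrite !setIT preimage_translate_cylinder.
rewrite !prob_cylinder; congr EFin.
rewrite (perm_big (map (addc a) s)) ?big_map /=; last first.
  apply: uniq_perm => [||v]; rewrite ?fset_uniq ?map_inj_uniq ?fset_uniq //.
    exact: addc_inj.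
  apply/idP/mapP => [|[w ws ->]]; last by rewrite mem_shift.
  by rewrite in_shift => h; exists (addc (oppc a) v); rewrite ?addcNK.
by apply: eq_bigr => v _; rewrite /translate /= addNcK.
Qed.

End FiniteDependence.

(** * Translates, reversals and segments of tricolor paths *)

Lemma card_shift (a : cell) (s : {fset cell}) : #|` shiftc a s| = #|` s|.
Proof. by rewrite card_imfset //; exact: addc_inj. Qed.

Lemma shiftNK (a : cell) : cancel (shiftc (oppc a)) (shiftc a).
Proof. by rewrite -{2}(oppcK a); exact: shiftK. Qed.

Lemma shiftS (a : cell) (s t : {fset cell}) : s `<=` t -> shiftc a s `<=` shiftc a t.
Proof.
move=> /fsubsetP st; apply/fsubsetP => v; rewrite !in_shift; exact: st.
Qed.

Lemma mutually_adjacent_shift (a : cell) (s : {fset cell}) :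
  mutually_adjacent s -> mutually_adjacent (shiftc a s).
Proof.
move=> hs v w; rewrite !in_shift => vs ws vw.
rewrite -(adjacent_shift (oppc a)); apply: hs => //.
by rewrite (inj_eq (@addc_inj _)).
Qed.

Lemma mutually_adjacent_close (s : {fset cell}) (u v : cell) :
  mutually_adjacent s -> u \in s -> v \in s -> closec 2 u v.
Proof.
move=> hs us vs; have [->|uv] := eqVneq u v; first exact: closec_refl.
by apply: adjacent_close; exact: hs.
Qed.

Section Paths.
Variable c : coloring.
Implicit Types xs es : seq {fset cell}.

Lemma tricolor_path_edge xs es k : tricolor_path c xs es -> (k < size es)%N ->
  [/\ tricolor_edge c (nth fset0 es k), tricolor_vertex c (nth fset0 xs k),
      tricolor_vertex c (nth fset0 xs k.+1),
      nth fset0 es k `<=` nth fset0 xs k &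
      nth fset0 es k `<=` nth fset0 xs k.+1].
Proof.
move=> [sz _ hx he hk] kL; have [_ ex ey] := hk k kL.
by split=> //; [apply: he|apply: hx|apply: hx]; apply: mem_nth => //;
  rewrite sz ltnS // ltnW.
Qed.

Lemma edge_cell (e : {fset cell}) : is_edge e -> exists v, v \in e.
Proof. by move=> [e3 _]; apply/fset0Pn; rewrite -cardfs_eq0 e3. Qed.

Lemma tricolor_path_common xs es k : tricolor_path c xs es ->
  (k < size es)%N ->
  exists2 v, v \in nth fset0 xs k & v \in nth fset0 xs k.+1.
Proof.
move=> hp /(tricolor_path_edge hp)[[/edge_cell[v ve] _] _ _ /fsubsetP h1 /fsubsetP h2].
by exists v; [exact: h1|exact: h2].
Qed.

Lemma tricolor_path_close xs es k u v : tricolor_path c xs es ->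
  (k < size xs)%N -> u \in nth fset0 xs k -> v \in nth fset0 xs k ->
  closec 2 u v.
Proof.
move=> [_ _ hx _ _] kL; apply: mutually_adjacent_close.
by have [[_ ?] _] := hx _ (mem_nth fset0 kL).
Qed.

Lemma tricolor_path_rev xs es :
  tricolor_path c xs es -> tricolor_path c (rev xs) (rev es).
Proof.
move=> [sz ues hx he hk]; split.
- by rewrite !size_rev.
- by rewrite rev_uniq.
- by move=> x; rewrite mem_rev; exact: hx.
- by move=> e; rewrite mem_rev; exact: he.
- move=> k; rewrite size_rev => kL /=.
  rewrite !nth_rev ?sz ?ltnS //; last exact: ltnW.
  have jL : (size es - k.+1 < size es)%N by lia.
  have [xy ex ey] := hk _ jL; rewrite subSS (_ : size es - k = (size es - k.+1).+1)%N.
    by split; rewrite // eq_sym.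
  by lia.
Qed.

Lemma tricolor_path_take xs es b : (b <= size es)%N ->
  tricolor_path c xs es -> tricolor_path c (take b.+1 xs) (take b es).
Proof.
move=> bL [sz ues hx he hk]; split.
- by rewrite !size_takel // sz.
- exact: take_uniq.
- by move=> x /mem_take; exact: hx.
- by move=> e /mem_take; exact: he.
- move=> k; rewrite size_takel // => kb /=.
  by rewrite !nth_take //; [apply: hk; exact: leq_trans bL|exact: ltnW].
Qed.

Lemma tricolor_path_drop xs es a : (a <= size es)%N ->
  tricolor_path c xs es -> tricolor_path c (drop a xs) (drop a es).
Proof.
move=> aL [sz ues hx he hk]; split.
- by rewrite !size_drop sz subSn.
- exact: drop_uniq.
- by move=> x /mem_drop; exact: hx.
- by move=> e /mem_drop; exact: he.
- move=> k; rewrite size_drop => kb /=.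
  by rewrite !nth_drop addnS; apply: hk; lia.
Qed.

Lemma tricolor_path_translate (a : cell) xs es : tricolor_path c xs es ->
  tricolor_path (translate a c) [seq shiftc (oppc a) x | x <- xs]
    [seq shiftc (oppc a) e | e <- es].
Proof.
move=> [sz ues hx he hk]; split.
- by rewrite !size_map.
- by rewrite map_inj_uniq //; exact: can_inj (shiftNK a).
- move=> _ /mapP[x /hx [[x4 xa] xc] ->]; split.
    by split; [rewrite card_shift|exact: mutually_adjacent_shift].
  move=> i; have [v vx <-] := xc i; exists (addc (oppc a) v).
    by rewrite mem_shift.
  by rewrite /translate /= addcNK.
- move=> _ /mapP[e /he [[e3 ea] ec] ->]; split.
    by split; [rewrite card_shift|exact: mutually_adjacent_shift].
  move=> v w; rewrite !in_shift oppcK => ve we vw.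
  by apply: ec => //; rewrite (inj_eq (@addc_inj _)).
- move=> k; rewrite size_map => kL /=.
  have kx : (k.+1 < size xs)%N by rewrite sz.
  rewrite !(nth_map fset0) //; last exact: ltnW.
  have [xy ex ey] := hk k kL.
  by split; [rewrite (can_eq (shiftNK a))|exact: shiftS|exact: shiftS].
Qed.

End Paths.

(** Every edge of the path is contained in a vertex of it, so control of the vertices suffices. *)
Lemma tricolor_path_local (s : {fset cell}) (c c' : coloring)
    (xs es : seq {fset cell}) :
  (forall x, x \in xs -> x `<=` s) -> (forall v, v \in s -> c v = c' v) ->
  tricolor_path c xs es -> tricolor_path c' xs es.
Proof.
move=> hs cc' hp; have [sz ues hx he hk] := hp; split=> //.
- move=> x xxs; have [xv xc] := hx x xxs; split=> // i.
  have [v vx <-] := xc i; exists v => //; rewrite cc' //.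
  by move/fsubsetP: (hs x xxs); apply.
- move=> e ees; have [ee ec] := he e ees; split=> // v w ve we vw.
  have es_s : e `<=` s.
    have kL : (index e es < size es)%N by rewrite index_mem.
    have := tricolor_path_edge hp kL; rewrite nth_index // => -[_ _ _ ex _].
    by apply: fsubset_trans ex _; apply: hs; rewrite mem_nth // sz ltnS ltnW.
  by rewrite -!cc' ?ec //; move/fsubsetP: es_s; apply.
Qed.

(** * Local crossings forced by long paths *)

(** The confinement makes the event depend on finitely many cells. The margin 2 leaves room for the
    last vertex, whose cells are within 2 of one in [[-3n,3n]^3]. *)
Definition local_crossing (n : nat) : set coloring_space :=
  [set c | exists xs es : seq {fset cell},
    [/\ tricolor_path c xs es, interior_boundary n (head fset0 xs),
        exterior_boundary n (last fset0 xs)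
      & forall x, x \in xs -> (x `<=` fcube (3 * n + 2))%fset]]%classic.

Lemma depends_on_local_crossing (n : nat) :
  depends_on (fcube (3 * n + 2)) (local_crossing n).
Proof.
move=> c c' cc' [xs [es [hp hi he hx]]]; exists xs, es; split=> //.
exact: (tricolor_path_local hx cc' hp).
Qed.

(** The crossing is the segment from the first vertex with a cell outside [[-n,n]^3] to the next one
    with a cell outside [[-3n,3n]^3]. *)
Lemma path_local_crossing_le (n : nat) (c : coloring) (xs es : seq {fset cell})
    (i j : nat) (u w : cell) :
  (0 < n)%N -> tricolor_path c xs es -> (i <= j < size xs)%N ->
  u \in nth fset0 xs i -> in_cube n u ->
  w \in nth fset0 xs j -> ~~ in_cube (3 * n) w -> local_crossing n c.
Proof.
move=> n0 hp /andP[ij jL] ui un wj wn.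
(* Cells of one vertex are within 2 of each other, so a vertex that meets [[-n,n]^3] stays inside
   [[-3n,3n]^3]; this puts the end vertices of the segment on the annulus. *)
have n2 : (n + 2 <= 3 * n)%N by clear -n0; lia.
pose out m k := has (fun v => ~~ in_cube m v) (nth fset0 xs k).
have outN m k v : ~~ out m k -> v \in nth fset0 xs k -> in_cube m v.
  by move=> /hasPn h /h; rewrite negbK.
have exa : exists k, (i <= k <= j)%N && out n k.
  exists j; rewrite ij leqnn /=; apply/hasP; exists w => //.
  by apply: contra wn; apply: in_cube_le; clear -n0; lia.
case: (ex_minnP exa) => a /andP[/andP[ia aj] outa] mina {exa}.
have aL : (a < size xs)%N by exact: leq_ltn_trans aj jL.
(* Either [a] is the starting index, or by minimality the preceding vertex lies inside the small
   cube and shares a cell with this one. The same argument gives [ub] below. *)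
have [ua uaa uan] : exists2 v, v \in nth fset0 xs a & in_cube n v.
  have [eia|nia] := eqVneq i a; first by exists u; rewrite -?eia.
  case: a ia aj outa mina aL nia => [|a] ia aj outa mina aL nia.
    by move: ia; rewrite leqn0 (negPf nia).
  have aL' : (a < size es)%N by case: hp aL => ->.
  have [v va va'] := tricolor_path_common hp aL'.
  exists v => //; apply: outN va; apply/negP => outa'.
  have := mina a; rewrite outa' andbT; clear -ia aj nia; lia.
have exb : exists k, (a <= k <= j)%N && out (3 * n)%N k.
  by exists j; rewrite aj leqnn; apply/hasP; exists w.
case: (ex_minnP exb) => b /andP[/andP[ab bj] outb] minb {exb}.
have bL : (b < size xs)%N by exact: leq_ltn_trans bj jL.
have near v : v \in nth fset0 xs a -> in_cube (3 * n) v.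
  move=> va.
  exact: in_cube_le n2 (in_cube_close uan (tricolor_path_close hp aL uaa va)).
have {ab} ab : (a < b)%N.
  rewrite ltn_neqAle ab andbT; apply: contraTneq outb => <-.
  by apply/hasPn => v /near ->.
have inb k : (a <= k < b)%N -> ~~ out (3 * n)%N k.
  move=> /andP[ak kb]; apply/negP => outk.
  have := minb k; rewrite outk andbT; clear -ak kb bj; lia.
have szE : size xs = (size es).+1 by case: hp.
have [ub ubb ubn] : exists2 v, v \in nth fset0 xs b & in_cube (3 * n) v.
  case: b ab bj outb minb bL inb => // b ab bj outb minb bL inb.
  have bL' : (b < size es)%N by rewrite -ltnS -szE.
  have [v vb vb'] := tricolor_path_common hp bL'.
  by exists v => //; apply: outN vb; apply: inb; rewrite -ltnS ab ltnSn.
have hv k : (k < size xs)%N -> is_vertex (nth fset0 xs k).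
  by case: hp => _ _ hx _ _ kL; have [] := hx _ (mem_nth fset0 kL).
have bE : (b <= size es)%N by rewrite -ltnS -szE.
have sz : size (take b.+1 xs) = b.+1 by rewrite size_takel.
exists (drop a (take b.+1 xs)), (drop a (take b es)); split.
- apply: tricolor_path_drop; first by rewrite size_takel // ltnW.
  exact: tricolor_path_take.
- rewrite -nth0 nth_drop addn0 nth_take; last exact: ltnW.
  split; [exact: hv| |by exists ua].
  have /hasP[v va vn] := outa; exists v => //; rewrite /annulus vn andbT.
  exact: near.
- rewrite -nth_last nth_drop size_drop sz subSn; last exact: ltnW.
  rewrite /= subnKC; last exact: ltnW.
  rewrite nth_take //; have /hasP[v vb vn] := outb.
  split; [exact: hv| |by exists v].
  exists ub => //; rewrite /annulus ubn /=; apply: contra vn => ubn'.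
  exact: in_cube_le n2 (in_cube_close ubn' (tricolor_path_close hp bL ubb vb)).
- move=> x /(nthP fset0)[k]; rewrite size_drop sz => kL <-.
  have kb : (a + k <= b)%N by clear -kL ab; lia.
  rewrite nth_drop nth_take //.
  apply/fsubsetP => v; rewrite in_fcube.
  have [->|kb'] := eqVneq (a + k)%N b => vx.
    exact: in_cube_close ubn (tricolor_path_close hp bL ubb vx).
  apply: in_cube_le (outN _ _ _ (inb _ _) vx); first exact: leq_addr.
  by rewrite leq_addr ltn_neqAle kb'.
Qed.

Lemma path_local_crossing (n : nat) (c : coloring) (xs es : seq {fset cell})
    (i j : nat) (u w : cell) :
  (0 < n)%N -> tricolor_path c xs es -> (i < size xs)%N -> (j < size xs)%N ->
  u \in nth fset0 xs i -> in_cube n u ->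
  w \in nth fset0 xs j -> ~~ in_cube (3 * n) w -> local_crossing n c.
Proof.
move=> n0 hp iL jL ui un wj wn; have [ij|ji] := leqP i j.
  by apply: (path_local_crossing_le n0 hp _ ui un wj wn); rewrite ij.
(* The path is run backwards; these are the positions of the two vertices in [rev xs]. *)
apply: (path_local_crossing_le (i := (size xs - i.+1)%N)
  (j := (size xs - j.+1)%N) n0 (tricolor_path_rev hp) _ _ un _ wn).
- by rewrite size_rev; clear -ji iL; lia.
- rewrite nth_rev; last by rewrite ltn_subrL (leq_ltn_trans _ iL).
  by rewrite subnSK // subKn // ltnW.
- rewrite nth_rev; last by rewrite ltn_subrL (leq_ltn_trans _ jL).
  by rewrite subnSK // subKn // ltnW.
Qed.

Lemma uniq_notin (T : eqType) (s t : seq T) :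
  uniq s -> (size t < size s)%N -> exists2 x, x \in s & x \notin t.
Proof.
move=> us ts; apply/hasP; apply: contraTT ts => /hasPn h.
by rewrite -leqNgt; apply: uniq_leq_size us _ => x /h; rewrite negbK.
Qed.

(** Pigeonhole: the edges are distinct, and there are more of them than subsets of the cube of
    radius [3n]. After recentering at [v], some edge therefore has a cell outside that cube, while
    [e] contains the origin. *)
Lemma long_path_local_crossing (n : nat) (c : coloring)
    (xs es : seq {fset cell}) (v : cell) (e : {fset cell}) :
  (0 < n)%N -> tricolor_path c xs es -> e \in es -> v \in e ->
  (#|` fpowerset (fcube (3 * n))| < size es)%N ->
  local_crossing n (translate v c).
Proof.
move=> n0 /(tricolor_path_translate v) hp ees ve big.
move: hp; set xs' := map _ xs; set es' := map _ es => hp.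
have sz : size es' = size es by rewrite size_map.
have szx : size xs' = (size es').+1 by case: hp.
have [e' e'es e'n] : exists2 e', e' \in es' & e' \notin fpowerset (fcube (3 * n)).
  by apply: uniq_notin; [case: hp|rewrite sz].
move: e'n; rewrite fpowersetE => /fsubsetPn[w we]; rewrite in_fcube => wn.
have e1 : shiftc (oppc v) e \in es' by exact: map_f.
have v1 : origin \in shiftc (oppc v) e by rewrite -(addNc v) mem_shift.
have sub e2 u : e2 \in es' -> u \in e2 ->
    (index e2 es' < size xs')%N /\ u \in nth fset0 xs' (index e2 es').
  move=> e2es ue2; have lt2 : (index e2 es' < size es')%N by rewrite index_mem.
  split; first by rewrite szx ltnS ltnW.
  have := tricolor_path_edge hp lt2; rewrite nth_index //.
  by move=> -[_ _ _ /fsubsetP ex _]; exact: ex.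
have [i1 i2] := sub _ _ e1 v1; have [j1 j2] := sub _ _ e'es we.
exact: path_local_crossing n0 hp i1 j1 i2 (in_cube_origin n) j2 wn.
Qed.

(** * Choosing separated cells along a path *)

Lemma nat_change (Q : pred nat) (i j N : nat) :
  (i < N)%N -> (j < N)%N -> Q i -> ~~ Q j ->
  exists2 k, (k.+1 < N)%N & Q k != Q k.+1.
Proof.
move=> iN jN Qi Qj; case: (pselect (exists2 k, (k.+1 < N)%N & Q k != Q k.+1)) => //.
move=> H; have const k : (k < N)%N -> Q k = Q 0%N.
  elim: k => // k IH kN; rewrite -IH 1?ltnW //; apply/eqP; rewrite eq_sym.
  by apply/negPn/negP => h; apply: H; exists k.
by move: Qi Qj; rewrite (const i) // (const j) // => ->.
Qed.

(* Greedy choice: as long as the cubes around the cells chosen so far do not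
   contain the whole path, the path leaves their union, and the first cell
   outside is at distance at most [r + 2] from a chosen one.  A walk through the
   chosen cells makes a detour to the new cell. *)
Lemma separated_cells (c : coloring) (xs es : seq {fset cell})
    (e0 : {fset cell}) (r m : nat) :
  tricolor_path c xs es -> e0 \in es -> origin \in e0 ->
  (m * #|` fpowerset (fcube (r + 2))| < size es)%N ->
  exists M w : seq cell,
    [/\ size M = m.+1 /\ uniq M,
        {in M &, forall u v, u != v -> ~~ closec r u v},
        forall v, v \in M -> exists2 e, e \in es & v \in e,
        path (closec (r + 2)) origin w & size w = m.*2 /\ {subset M <= origin :: w}].
Proof.
move=> hp e0es oe0; elim: m => [_|m IH hm].
  exists [:: origin], [::]; split=> //; last by split.
    by move=> u v; rewrite !inE => /eqP -> /eqP ->; rewrite eqxx.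
  by move=> v; rewrite inE => /eqP ->; exists e0.
case: IH => [|M [w [[sM uM] pM hM pw [sw Mw]]]].
  by apply: leq_ltn_trans hm; rewrite leq_mul2r leqnSn orbT.
pose near (e : {fset cell}) := has (fun v => has (closec r v) e) M.
have [e1 e1es e1n] : exists2 e, e \in es & ~~ near e.
  (* Cells of an edge are within 2 of each other, so a near edge is a subset of the cube of radius
     [r + 2] around one of the [m.+1] chosen cells. The path has more edges than there are such
     subsets. *)
  have [||e ees en] := @uniq_notin _ es
      (flatten [seq [seq shiftc v s | s <- fpowerset (fcube (r + 2))] | v <- M]).
  - by case: hp.
  - rewrite size_flatten /shape -map_comp.
    rewrite (eq_map (_ : _ =1 fun=> #|` fpowerset (fcube (r + 2))|)); last first.
      by move=> v /=; rewrite size_map.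
    by rewrite sumnE big_map big_const_seq count_predT iter_addn_0 mulnC sM.
  exists e => //; apply: contra en => /hasP[v vM /hasP[u ue vu]].
  apply/flatten_mapP; exists v => //; apply/mapP; exists (shiftc (oppc v) e).
    rewrite fpowersetE; apply/fsubsetP => u'; rewrite in_shift oppcK in_fcube => u'e.
    have [[_ ea] _] : tricolor_edge c e by case: hp => _ _ _ + _; apply.
    have := closec_trans vu (mutually_adjacent_close ea ue u'e).
    by rewrite /closec addNcK.
  by rewrite shiftNK.
have [e2 e2es e2n] : exists2 e, e \in es & near e.
  have [v vM] : exists v, v \in M.
    by case: (M) sM => // v ? _; exists v; exact: mem_head.
  have [e ees ve] := hM v vM; exists e => //; apply/hasP; exists v => //.
  by apply/hasP; exists v => //; exact: closec_refl.
(* Nearness changes between two consecutive edges, in either order. The near one [a] and the other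
   one [b] share the vertex [x], so every cell of [b] is within [r + 2] of a chosen cell. *)
have [x [a [b [[xv aes bes] [xa ax bx]]]]] : exists x a b : {fset cell},
    [/\ is_vertex x, a \in es & b \in es] /\
    [/\ near a && ~~ near b, a `<=` x & b `<=` x].
  have [k kL hk] : exists2 k, (k.+1 < size es)%N &
      near (nth fset0 es k) != near (nth fset0 es k.+1).
    by apply: (@nat_change _ (index e2 es) (index e1 es));
      rewrite ?index_mem ?nth_index.
  have [_ _ [xv _] _ ax] := tricolor_path_edge hp (ltnW kL).
  have [_ _ _ bx _] := tricolor_path_edge hp kL.
  have i1 : nth fset0 es k \in es by rewrite mem_nth // ltnW.
  have i2 : nth fset0 es k.+1 \in es by rewrite mem_nth.
  exists (nth fset0 xs k.+1); move: hk; case h1: (near _); case h2: (near _) => // _.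
    by exists (nth fset0 es k), (nth fset0 es k.+1); rewrite h1 h2.
  by exists (nth fset0 es k.+1), (nth fset0 es k); rewrite h1 h2.
case/andP: xa => /hasP[v vM /hasP[u ua vu]] /hasPn bn.
have [u' u'b] : exists u', u' \in b.
  by apply: edge_cell; case: hp => _ _ _ he _; case: (he b bes).
have vu' : closec (r + 2) v u'.
  apply: closec_trans vu (mutually_adjacent_close xv.2 _ _).
    by move/fsubsetP: ax; apply.
  by move/fsubsetP: bx; apply.
have vow := Mw v vM; move: pw sw Mw; case/splitPl: w / vow => p1 p2 lv.
rewrite cat_path lv => /andP[pp1 pp2] sw Mw.
have far z : z \in M -> ~~ closec r z u'.
  by move=> /bn; apply: contra => h; apply/hasP; exists u'.
exists (u' :: M), (p1 ++ u' :: v :: p2); split.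
- split; rewrite /= ?sM // uM andbT; apply: contraT => /negbNE /far.
  by rewrite closec_refl.
- move=> z1 z2; rewrite !inE => /orP[/eqP ->|z1M] /orP[/eqP ->|z2M].
  + by rewrite eqxx.
  + by rewrite closec_sym => _; exact: far.
  + by move=> _; exact: far.
  + exact: pM.
- by move=> z; rewrite inE => /orP[/eqP ->|/hM //]; exists b.
- by rewrite cat_path pp1 lv /= vu' closec_sym vu' pp2.
- split; first by move: sw; rewrite !size_cat /= !addnS doubleS => ->.
  move=> z; rewrite !inE mem_cat !inE => /orP[->|/Mw]; first by rewrite !orbT.
  by rewrite inE mem_cat => /or3P[] ->; rewrite ?orbT.
Qed.

(** * Counting walks with marked cells *)

(* Lists the subsequences of all walks of [N] steps in [D] started at [v]. *)
Fixpoint marked (D : seq cell) (N : nat) (v : cell) : seq (seq cell) :=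
  let tails := if N is N'.+1 then flatten [seq marked D N' (addc v d) | d <- D]
    else [:: [::]] in
  tails ++ map (cons v) tails.

(** Each of the [N] steps is chosen in [D], and each of the [N.+1] visited cells is kept or
    dropped. *)
Lemma size_marked (D : seq cell) (N : nat) (v : cell) :
  size (marked D N v) = (2 ^ N.+1 * size D ^ N)%N.
Proof.
elim: N v => [|N IH] v //=; rewrite size_cat size_map addnn -muln2.
rewrite size_flatten /shape -map_comp.
rewrite (eq_map (_ : _ =1 fun=> 2 ^ N.+1 * size D ^ N)%N) => [|d /=]; last exact: IH.
rewrite sumnE big_map big_const_seq count_predT iter_addn_0.
by rewrite [in RHS]expnS [(size D ^ _)%N in RHS]expnS; lia.
Qed.

Lemma mem_marked (k : nat) (v : cell) (w s : seq cell) :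
  path (closec k) v w -> subseq s (v :: w) -> s \in marked (cube k) (size w) v.
Proof.
elim: w v s => [|u w IH] v s.
  case: s => [|x s] _ /=; first by rewrite !inE.
  by case: (x =P v) => [->|//]; case: s => // _; rewrite !inE eqxx.
move=> /= /andP[vu pw].
have tails t : subseq t (u :: w) ->
    t \in flatten [seq marked (cube k) (size w) (addc v d) | d <- cube k].
  move=> tw; apply/flatten_mapP; exists (addc (oppc v) u); first by rewrite mem_cube.
  by rewrite addcNK; exact: IH.
rewrite mem_cat; case: s => [|x s]; first by rewrite tails ?sub0seq.
case: eqP => [->|_] h; last by rewrite tails.
by rewrite map_f ?orbT // tails.
Qed.

(** * Measurability and the union bound for long paths *)

Section Probability.
Local Open Scope classical_set_scope.
Variables (R : realType) (P : probability coloring_space R).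

(** There are countably many pairs of finite sequences, and being a tricolor path is, for each pair,
    determined by the finitely many cells of its vertices. *)
Lemma measurable_exists_tricolor_path
    (Q : seq {fset cell} -> seq {fset cell} -> Prop) :
  measurable ([set c | exists xs es, tricolor_path c xs es /\ Q xs es] :
    set coloring_space).
Proof.
rewrite [X in measurable X](_ : _ = \bigcup_(x : seq {fset cell} * seq {fset cell})
  [set c : coloring_space | tricolor_path c x.1 x.2 /\ Q x.1 x.2]); last first.
  apply/seteqP; split=> [c [xs [es h]]|c [[xs es] _ h]]; last by exists xs, es.
  by exists (xs, es).
apply: countable_bigcupT_measurable => [|[xs es] /=]; first exact: countableP.
apply: (@measurable_depends_on (\bigcup_(x <- xs) x)%fset) => c c' cc' [hp hQ].
split=> //; apply: tricolor_path_local cc' hp => x xxs.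
by apply: (@bigfcup_sup _ _ _ _ _ id).
Qed.

Lemma measurable_crossing (n : nat) : measurable (crossing n : set coloring_space).
Proof.
have := measurable_exists_tricolor_path (fun xs _ =>
  interior_boundary n (head fset0 xs) /\ exterior_boundary n (last fset0 xs)).
congr measurable; apply/seteqP.
by split=> c [xs [es]]; [move=> [hp [hi he]]|move=> [hp hi he]]; exists xs, es.
Qed.

Lemma measurable_on_path_of_length (e : {fset cell}) (L : nat) :
  measurable (on_path_of_length e L : set coloring_space).
Proof.
have := measurable_exists_tricolor_path (fun _ es => size es = L /\ e \in es).
congr measurable; apply/seteqP.
by split=> c [xs [es]]; [move=> [hp [hi he]]|move=> [hp hi he]]; exists xs, es.
Qed.

Lemma prob_union_bound (I : eqType) (l : seq I) (F : I -> set coloring_space)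
    (A : set coloring_space) (b : R) :
  (forall i, measurable (F i)) -> (forall i, i \in l -> (P (F i) <= b%:E)%E) ->
  measurable A -> (forall c, A c -> exists2 i, i \in l & F i c) ->
  (P A <= (b *+ size l)%:E)%E.
Proof.
move=> mF; elim: l A => [|i l IH] A hb mA hA.
  rewrite (_ : A = set0) ?measure0 //.
  by apply/seteqP; split=> // c /hA[].
have mAi : measurable (A `\` F i) by exact: measurableD.
have mU : measurable (F i `|` (A `\` F i)) by exact: measurableU.
apply: (@le_trans _ _ (P (F i `|` (A `\` F i)))).
  apply: le_measure; rewrite ?inE // => c Ac.
  by have [|] := pselect (F i c); [left|right].
apply: le_trans (measureU2 _ _ _) _ => //; rewrite /= mulrS EFinD leeD //.
  by apply: hb; rewrite mem_head.
apply: IH => // [j jl|c [/hA[j + Fj] Fi]]; first by apply: hb; rewrite inE jl orbT.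
by rewrite inE => /orP[/eqP ji|jl]; [case: Fi; rewrite -ji|exists j].
Qed.

Variable p : 'I_3 -> R.
Hypothesis hP : is_coloring_law p P.

Lemma disjoint_cubes (k r : nat) (u v : cell) : (k + k <= r)%N ->
  ~~ closec r u v -> [disjoint shiftc u (fcube k) & shiftc v (fcube k)]%fset.
Proof.
move=> kr uv; apply/fdisjointP => x; rewrite !in_shift !in_fcube => ux.
apply: contra uv => vx; apply: closec_le kr _; apply: closec_trans ux _.
by rewrite closec_sym.
Qed.

(** The bound on [r] is twice the radius [3n + 2], so the supports are disjoint; independence gives
    a product and invariance makes its factors equal. *)
Lemma prob_separated_crossings (n r : nat) (s : seq cell) :
  (6 * n + 4 <= r)%N -> pairwise (fun u v => ~~ closec r u v) s ->
  P [set c | forall v, v \in s -> local_crossing n (translate v c)] =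
    ((fine (P (local_crossing n))) ^+ size s)%:E.
Proof.
move=> nr hs; have hF := @depends_on_local_crossing n.
rewrite (@prob_depends_bigcap _ _ _ hP _ s
  (fun v => shiftc v (fcube (3 * n + 2)))
  (fun v => translate v @^-1` local_crossing n)).
- elim: s {hs} => [|v s IH]; first by rewrite big_nil.
  rewrite big_cons IH (prob_translate hP _ hF) /= exprS EFinM fineK //.
  apply: fin_num_measure; exact: measurable_depends_on hF.
- apply: sub_pairwise hs => u v; apply: disjoint_cubes.
  by apply: leq_trans nr; lia.
- by move=> v; exact: depends_on_translate.
Qed.

Lemma prob_local_crossing_le (n : nat) :
  (P (local_crossing n) <= P (crossing n))%E.
Proof.
apply: le_measure; rewrite ?inE.
- exact: measurable_depends_on (@depends_on_local_crossing n).
- exact: measurable_crossing.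
- by move=> c [xs [es [hp hi he _]]]; exists xs, es.
Qed.

(** Union bound over the marked walks of [2m] steps. The first bound on [L] forces a local crossing
    at every cell of the path, the second yields [m.+1] separated cells on it. *)
Lemma prob_on_path_le (n m L : nat) (e : {fset cell}) :
  (0 < n)%N -> origin \in e ->
  (#|` fpowerset (fcube (3 * n))| < L)%N ->
  (m * #|` fpowerset (fcube (6 * n + 6))| < L)%N ->
  (P (on_path_of_length e L) <=
    (fine (P (local_crossing n)) ^+ m.+1 *+
      (2 ^ m.*2.+1 * size (cube (6 * n + 6)) ^ m.*2))%:E)%E.
Proof.
move=> n0 oe hL hm; set r := (6 * n + 4)%N; set q := fine _.
have r2 : (6 * n + 6 = r + 2)%N by rewrite /r -addnA.
pose sep := pairwise (fun u v => ~~ closec r u v).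
pose good (s : seq cell) := (size s == m.+1) && sep s.
pose F (s : seq cell) : set coloring_space :=
  [set c | forall v, v \in s -> local_crossing n (translate v c)].
have hF := @depends_on_local_crossing n.
have q0 : 0 <= q by exact: fine_ge0.
apply: (@le_trans _ _ (q ^+ m.+1 *+
    size [seq s <- marked (cube (r + 2)) m.*2 origin | good s])%:E); last first.
  rewrite lee_fin -(size_marked _ _ origin) r2 ler_wpMn2l ?exprn_ge0 //.
  by rewrite size_filter count_size.
apply: (@prob_union_bound _ _ F).
- move=> s; apply: (@measurable_depends_on
    (\bigcup_(v <- s) shiftc v (fcube (3 * n + 2)))%fset) => c c' cc' h v vs.
  apply: (depends_on_translate hF) (h v vs) => u uv; apply: cc'.
  by apply/bigfcupP; exists v; rewrite ?vs.
- move=> s; rewrite mem_filter => /andP[/andP[/eqP sm ss] _].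
  by rewrite /F (@prob_separated_crossings n r) // sm.
- exact: measurable_on_path_of_length.
move=> c [xs [es [hp sz ees]]].
have [|M [w [[sM uM] pM hM pw [sw Mw]]]] := @separated_cells c xs es e r m hp ees oe.
  by rewrite -r2 sz.
(* The cells of [M] rearranged along the walk, so that they form a subsequence of it. *)
pose s := [seq v <- undup (origin :: w) | v \in M].
have us : uniq s by rewrite filter_uniq ?undup_uniq.
have sM' : s =i M.
  move=> v; rewrite mem_filter mem_undup.
  by case: (boolP (v \in M)) => // /Mw ->.
exists s; last first.
  move=> v; rewrite sM' => /hM[e' e'es ve'].
  by apply: long_path_local_crossing n0 hp e'es ve' _; rewrite sz.
rewrite mem_filter -sw mem_marked ?andbT //; last first.
  exact: subseq_trans (filter_subseq _ _) (undup_subseq _).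
apply/andP; split; first by rewrite (perm_size (uniq_perm us uM sM')) sM.
rewrite /sep; move: us; rewrite uniq_pairwise.
apply: (@sub_in_pairwise _ (mem M)) => [u v uM' vM'|]; first exact: pM.
by apply/allP => v; rewrite sM'.
Qed.

End Probability.

(** * Choice of the constants and exponential decay *)

(** With [x = c * n], the exponential is at least its series term [x ^ k.+1 / k.+1!], which has one
    power of [n] to spare; [n] is taken beyond the resulting threshold. *)
Lemma exp_beats_poly (R : realType) (k : nat) (A c : R) : 0 < c ->
  exists2 n : nat, (0 < n)%N & A * n%:R ^+ k * expR (- c * n%:R) <= 1.
Proof.
move=> c0; pose n := (Num.truncn (A * k.+1`!%:R / c ^+ k.+1)).+1.
have n0 : 0 < n%:R :> R by rewrite ltr0n.
have f0 : 0 < k.+1`!%:R :> R by rewrite ltr0n fact_gt0.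
exists n => //; rewrite mulNr expRN ler_pdivrMr ?expR_gt0 // mul1r.
apply: (@le_trans _ _ ((c * n%:R) ^+ k.+1 / k.+1`!%:R)); last first.
  apply: le_trans _ (expR_ge1Dxn k _); first by rewrite lerDr.
  by rewrite mulr_ge0 // ltW.
rewrite ler_pdivlMr // exprMn [n%:R ^+ k.+1]exprSr mulrAC mulrCA mulrC.
rewrite ler_pM2l ?exprn_gt0 // -ler_pdivrMl ?exprn_gt0 // mulrC.
exact: ltW (truncnS_gt _).
Qed.

Theorem theorem1p3 (R : realType) (p : 'I_3 -> R) (hp : in_simplex p)
    (P : probability coloring_space R) (hP : is_coloring_law p P)
    (hc : compact_phase P) :
  exists C c : R, [/\ 0 < C, 0 < c &
    forall (e : {fset cell}) (L : nat), is_edge e -> origin \in e ->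
      (1 <= L)%N ->
      (P (on_path_of_length e L) <= (C * expR (- c * L%:R))%:E)%E].
Proof.
have [C [c [C0 c0 hC]]] := hc.
(* Chosen so that [4 * D ^ 2 * q] is at most [1/e], given [D <= (25 n) ^ 3] and
   [q <= C * expR (- c * n)]. *)
have [n n0 hn] := exp_beats_poly 6 (4 * 25 ^+ 6 * C * expR 1) c0.
pose q := fine (P (local_crossing n)).
have fq : P (local_crossing n) \is a fin_num.
  by apply: fin_num_measure; exact: measurable_depends_on (@depends_on_local_crossing n).
have q0 : 0 <= q by exact: fine_ge0.
pose D := size (cube (6 * n + 6)).
have D0 : (0 < D)%N.
  rewrite -has_predT; apply/hasP; exists origin => //.
  by rewrite mem_cube in_cube_origin.
(* The cube of radius [6n + 6] has side [12n + 13], at most [25n] as [n >= 1]. *)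
have hD : D%:R <= (25 * n%:R) ^+ 3 :> R.
  rewrite -natrM -natrX ler_nat (leq_trans (size_cube _)) // leq_exp2r //.
  by clear -n0; lia.
have hq : 4 * D%:R ^+ 2 * q <= expR (-1).
  rewrite expRN -[leRHS]div1r ler_pdivlMr ?expR_gt0 //; apply: le_trans hn.
  have qC : q <= C * expR (- c * n%:R).
    by rewrite -lee_fin fineK //; apply: le_trans (prob_local_crossing_le P n) (hC n n0).
  have D2 : D%:R ^+ 2 <= 25 ^+ 6 * n%:R ^+ 6 :> R.
    by rewrite -exprMn (exprM _ 3 2) lerXn2r ?nnegrE ?exprn_ge0 ?mulr_ge0.
  have := ler_pM (exprn_ge0 2 (ler0n R D)) q0 D2 qC.
  move=> /(ler_wpM2l (ler0n R 4)) /(ler_wpM2r (expR_ge0 1)).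
  by congr (_ <= _); ring.
pose K := #|` fpowerset (fcube (6 * n + 6))|.
have K0 : (0 < K)%N by rewrite /K card_fpowerset expn_gt0.
have K0' : 0 < K%:R :> R by rewrite ltr0n.
(* The rate is [1/K], as each further separated cell costs [K] edges. The factor [e] makes the bound
   at least 1, hence trivial, for [L <= K]. *)
exists (expR 1), K%:R^-1; split; rewrite ?expR_gt0 ?invr_gt0 // => e L _ oe L0.
rewrite -expRD.
have [LK|KL] := leqP L K.
  apply: le_trans (probability_le1 _ (measurable_on_path_of_length e L)) _.
  rewrite lee_fin -[leLHS]expR0 ler_expR mulNr subr_ge0 ler_pdivrMl // mulr1.
  by rewrite ler_nat.
(* The largest [m] with [m * K < L]; hence also [L <= m.+1 * K]. *)
pose m := (L.-1 %/ K)%N.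
apply: le_trans (prob_on_path_le (m := m) hP n0 oe _ _) _.
- apply: leq_ltn_trans KL; rewrite /K !card_fpowerset leq_exp2l //.
  apply: fsubset_leq_card; apply/fsubsetP => v; rewrite !in_fcube.
  by apply: in_cube_le; clear; lia.
- by rewrite -(prednK L0) ltnS; exact: leq_trunc_div.
(* Exponents are rounded up to match [q ^+ m.+1], so that the bound becomes a power of
   [4 * D ^ 2 * q]. *)
have count : (2 ^ m.*2.+1 * D ^ m.*2 <= (4 * D ^ 2) ^ m.+1)%N.
  have -> : (4 * D ^ 2 = (2 * D) ^ 2)%N by rewrite expnMn.
  rewrite -expnM (mul2n m.+1) doubleS expnMn.
  by rewrite leq_mul // leq_pexp2l // -addn2 leq_addr.
rewrite lee_fin -/D -/q; apply: (@le_trans _ _ (expR (-1) ^+ m.+1)).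
  apply: (@le_trans _ _ (q ^+ m.+1 *+ (4 * D ^ 2) ^ m.+1)).
    by rewrite ler_wpMn2l // exprn_ge0.
  rewrite -mulr_natl natrX -exprMn natrM natrX lerXn2r ?nnegrE ?expR_ge0 //.
  by rewrite !mulr_ge0.
rewrite -expRM_natl ler_expR mulrN1 mulNr [K%:R^-1 * _]mulrC.
have LmK : L%:R / K%:R <= m.+1%:R :> R.
  rewrite ler_pdivrMr // -natrM ler_nat -(prednK L0).
  by rewrite ltn_ceil.
lra.
Qed.
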